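(* For any $\mu_1,\mu_2\in M_4(\mathbb{R})$ such that the Pauli diagonal maps $\Pi^{(2)}_{\mu_1},\Pi^{(2)}_{\mu_2}:\mathcal{M}_4\to\mathcal{M}_4$ are both completely positive and completely copositive, the composition $\Pi^{(2)}_{\mu_1}\circ\Pi^{(2)}_{\mu_2}$ is entanglement breaking.
   Context: Pauli matrices $\sigma_1=I_2$, $\sigma_2=\begin{pmatrix}0&1\\1&0\end{pmatrix}$, $\sigma_3=\begin{pmatrix}1&0\\0&-1\end{pmatrix}$, $\sigma_4=\begin{pmatrix}0&-i\\i&0\end{pmatrix}$; $\Pi^{(2)}_\mu(X)=\sum_{i,j}\frac{\mu_{ij}}4\mathrm{Tr}[(\sigma_i\otimes\sigma_j)X]\sigma_i\otimes\sigma_j$ on $\mathcal{M}_2\otimes\mathcal{M}_2\cong\mathcal{M}_4$. Completely copositive means $\vartheta\circ L$ is completely positive, $\vartheta$ the transpose. Entanglement breaking means the Choi matrix $(\mathrm{id}\otimes L)(|\Omega\rangle\langle\Omega|)$, $|\Omega\rangle=\sum_i|i\rangle\otimes|i\rangle$, is separable. *)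

(* Defs.v *)
From HB Require Import structures.
From mathcomp Require Import all_boot all_order all_algebra.
From mathcomp Require Import reals.
From mathcomp.real_closed Require Import complex mxtens.

Set Implicit Arguments.
Unset Strict Implicit.
Unset Printing Implicit Defensive.

Import Order.TTheory GRing.Theory Num.Theory.
Local Open Scope ring_scope.

Definition adjmx {C : numClosedFieldType} {m n} (A : 'M[C]_(m, n)) : 'M[C]_(n, m) :=
  (map_mx Num.conj A)^T.

(* positive semidefinite: Hermitian with nonnegative quadratic form
   (in a numClosedFieldType, [0 <= z] means z is real and nonnegative). *)
Definition psdmx {C : numClosedFieldType} {n} (A : 'M[C]_n) : Prop :=
  adjmx A = A /\ forall v : 'cV[C]_n, 0 <= (adjmx v *m A *m v) 0 0.

(* the ampliation (id_n (x) L) acting on M_n (x) M_d = M_(n*d),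
   with Kronecker index convention of mxtens (k = a * d + i). *)
Definition ampl {C : numClosedFieldType} {d} (n : nat)
  (L : 'M[C]_d -> 'M[C]_d) (X : 'M[C]_(n * d)) : 'M[C]_(n * d) :=
  \matrix_(p, q)
    L (\matrix_(i, j) X (mxtens_index ((mxtens_unindex p).1, i))
                        (mxtens_index ((mxtens_unindex q).1, j)))
      (mxtens_unindex p).2 (mxtens_unindex q).2.
Arguments ampl {C d} n L X.

Definition completely_positive {C : numClosedFieldType} {d}
  (L : 'M[C]_d -> 'M[C]_d) : Prop :=
  forall (n : nat) (X : 'M[C]_(n * d)), psdmx X -> psdmx (ampl n L X).

Definition completely_copositive {C : numClosedFieldType} {d}
  (L : 'M[C]_d -> 'M[C]_d) : Prop :=
  completely_positive (fun X => (L X)^T).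

Definition Omega {C : numClosedFieldType} (d : nat) : 'cV[C]_(d * d) :=
  \col_k ((mxtens_unindex k).1 == (mxtens_unindex k).2)%:R.

Definition choi {C : numClosedFieldType} {d} (L : 'M[C]_d -> 'M[C]_d)
  : 'M[C]_(d * d) :=
  ampl d L (Omega d *m adjmx (Omega d)).

Definition separable {C : numClosedFieldType} {d1 d2}
  (M : 'M[C]_(d1 * d2)) : Prop :=
  exists (N : nat) (A : 'I_N -> 'M[C]_d1) (B : 'I_N -> 'M[C]_d2),
    (forall k, psdmx (A k) /\ psdmx (B k)) /\ M = \sum_(k < N) (A k *t B k).

Definition entanglement_breaking {C : numClosedFieldType} {d}
  (L : 'M[C]_d -> 'M[C]_d) : Prop :=
  separable (choi L).

(* Pauli matrices sigma_1 = I, sigma_2 = X, sigma_3 = Z, sigma_4 = Y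
   (indexed 0..3 here). *)
Definition pauli {R : realType} (k : 'I_4) : 'M[R[i]]_2 :=
  match val k with
  | 0 => 1%:M
  | 1 => \matrix_(a, b) (if a == b then 0 else 1)
  | 2 => \matrix_(a, b) (if a == b then (if val a == 0%N then 1 else -1) else 0)
  | _ => \matrix_(a, b) (if a == b then 0
                         else if val a == 0%N then - Complex 0 1 else Complex 0 1)
  end.

Definition pauli_diag {R : realType} (mu : 'M[R]_4) (X : 'M[R[i]]_4)
  : 'M[R[i]]_4 :=
  \sum_(i < 4) \sum_(j < 4)
     ((real_complex R (mu i j)) / 4%:R * \tr ((pauli i *t pauli j) *m X))
       *: (pauli i *t pauli j).

(* Main.v *)
Require Import Defs.
From Stdlib Require Import NArith.
From HB Require Import structures.
From mathcomp Require Import all_boot all_order all_algebra.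
From mathcomp Require Import reals.
From mathcomp.real_closed Require Import complex mxtens.
From mathcomp Require Import ring lra.

(** Pauli indices are identified with vectors of F_2^2, so that the Kraus weights
of a two-qubit Pauli diagonal map form a function p on the symplectic space
V = F_2^4, the Fourier transform of mu.  Complete positivity says p >= 0;
complete copositivity says q >= 0, where q is a linear involutive transform of
p.  Composition of maps multiplies the mu's, hence convolves the p's.

The polyhedral cone { p, q >= 0 } has 252 extreme rays, all of them 0/1 vectors:
the indicators of the 60 cosets of Lagrangian subspaces of V, which are
entanglement breaking (measure and prepare a stabilizer basis), and 192
"hooks".  The convolution of a coset with any p >= 0 is a sum of
translated cosets, and the convolution of two hooks, of total mass 36, is a sum
of nine cosets.  Hence the convolution of two elements of the cone always lies
in the cone of Lagrangian cosets. *)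

Set Implicit Arguments.
Unset Strict Implicit.
Unset Printing Implicit Defensive.

Import Order.TTheory GRing.Theory Num.Theory.
Local Open Scope nat_scope.

(** * Refutation of support patterns *)

(* A pair (a, b) of bit masks stands for the implication "if all the variables
   in a vanish then so do all the variables in b"; a mask u among the last
   argument of [refute] for "not all the variables in u are positive".  [Z] and
   [P] collect the variables known to vanish, resp. to be positive. *)
Section Search.

Definition emptyN (a : N) : bool := if a is N0 then true else false.
Definition singleton (a : N) : bool := N.eqb a (N.shiftl 1 (N.log2 a)).

Fixpoint pos_weight (p : positive) : nat :=
  match p with
  | xH => 1
  | xO p => pos_weight p
  | xI p => (pos_weight p).+1
  end.
Definition weight (a : N) : nat := if a is Npos p then pos_weight p else 0.

(** Unit propagation. [Z] forces a right-hand side to vanish once the left-hand side does.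
    Contrapositively, a positive variable on the right makes the left positive when only one
    candidate remains there. [None] signals a contradiction. *)
Fixpoint propagate (Z P : N) (rs out : seq (N * N)) :
    option (N * N * seq (N * N)) :=
  if rs is (a, b) :: rs' then
    if ~~ emptyN (N.land a P) then propagate Z P rs' out else
    let b' := N.ldiff b Z in
    if emptyN b' then propagate Z P rs' out else
    let a' := N.ldiff a Z in
    if emptyN a' then
      if emptyN (N.land b' P) then propagate (N.lor Z b') P rs' out else None
    else if ~~ emptyN (N.land b' P) && singleton a' then
      propagate Z (N.lor P a') rs' out
    else propagate Z P rs' ((a', b') :: out)
  else Some (Z, P, out).

Fixpoint prune (Z P : N) (us out : seq N) : option (N * seq N) :=
  if us is u :: us' then
    if ~~ emptyN (N.land u Z) then prune Z P us' out else
    let u' := N.ldiff u P in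
    if emptyN u' then None else
    if singleton u' then prune (N.lor Z u') P us' out
    else prune Z P us' (u' :: out)
  else Some (Z, out).

Definition lightest (u : N) (us : seq N) : N :=
  (foldl (fun bc v => let c := weight v in if c < bc.2 then (v, c) else bc)
     (u, weight u) us).1.

(** A case split happens only once propagation is stationary. Soundness holds for any branching
    variable, so [lightest] merely steers the search; exhausted fuel counts as failure. *)
Fixpoint refute (fuel : nat) (Z P : N) (rs : seq (N * N)) (us : seq N) : bool :=
  if fuel is n.+1 then
    if propagate Z P rs [::] is Some (Z1, P1, rs1) then
      if prune Z1 P1 us [::] is Some (Z2, us2) then
        if N.eqb Z2 Z && N.eqb P1 P then
          if us2 is u :: us3 then
            let b := N.shiftl 1 (N.log2 (lightest u us3)) in
            refute n (N.lor Z2 b) P1 rs1 us2 && refute n Z2 (N.lor P1 b) rs1 us2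
          else false
        else refute n Z2 P1 rs1 us2
      else true
    else true
  else false.

Variable s : N -> bool.

Definition below (m : N) := forall n, N.testbit m n -> s n.
Definition avoid (m : N) := forall n, N.testbit m n -> ~~ s n.
Definition implied (ab : N * N) := avoid ab.1 -> avoid ab.2.

Lemma emptyNP a n : emptyN a -> N.testbit a n = false.
Proof. by case: a => //; rewrite N.bits_0. Qed.

Lemma emptyNPn a : ~~ emptyN a -> exists n, N.testbit a n.
Proof. by case: a => // p _; exists (N.log2 (N.pos p)); rewrite N.bit_log2. Qed.

Lemma singletonP a m n :
  singleton a -> N.testbit a m -> N.testbit a n -> m = n.
Proof.
move/N.eqb_eq=> ->; rewrite N.shiftl_1_l !N.pow2_bits_eqb.
by move=> /N.eqb_eq <- /N.eqb_eq <-.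
Qed.

Lemma avoid_lor a b : avoid a -> avoid b -> avoid (N.lor a b).
Proof. by move=> ha hb n; rewrite N.lor_spec => /orP[/ha|/hb]. Qed.

Lemma below_lor a b : below a -> below b -> below (N.lor a b).
Proof. by move=> ha hb n; rewrite N.lor_spec => /orP[/ha|/hb]. Qed.

Lemma avoid_ldiff a Z : avoid Z -> avoid (N.ldiff a Z) -> avoid a.
Proof.
move=> hZ h n an; case: (boolP (N.testbit Z n)) => [/hZ//|nZ].
by apply: h; rewrite N.ldiff_spec an.
Qed.

Lemma avoid_sub a Z : avoid a -> avoid (N.ldiff a Z).
Proof. by move=> h n; rewrite N.ldiff_spec => /andP[/h]. Qed.

Lemma below_ldiff a P : below P -> below (N.ldiff a P) -> below a.
Proof.
move=> hP h n an; case: (boolP (N.testbit P n)) => [/hP//|nP].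
by apply: h; rewrite N.ldiff_spec an.
Qed.


Lemma singletonPn a : singleton a -> ~ avoid a -> below a.
Proof.
move=> a1 na n an; case: (boolP (s n)) => // sn; case: na => m am.
by rewrite (singletonP a1 am an).
Qed.

Lemma singleton_avoid a : singleton a -> ~ below a -> avoid a.
Proof.
move=> a1 na n an; apply/negP => sn; case: na => m am.
by rewrite (singletonP a1 am an).
Qed.

Lemma propagate_sound Z P rs out :
  avoid Z -> below P -> (forall ab, ab \in rs ++ out -> implied ab) ->
  if propagate Z P rs out is Some (Z', P', rs') then
    [/\ avoid Z', below P' & forall ab, ab \in rs' -> implied ab]
  else False.
Proof.
elim: rs Z P out => [|[a b] rs IH] Z P out hZ hP hrs //=.
have hab : implied (a, b) by apply: hrs; rewrite mem_head.
have hrs' ab : ab \in rs ++ out -> implied ab.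
  by move=> h; apply: hrs; rewrite inE h orbT.
case: ifP => _; first exact: IH.
case: ifP => _; first exact: IH.
case: ifPn => [a0|_].
  have hb : avoid b.
    by apply: hab; apply: (avoid_ldiff hZ) => n; rewrite (emptyNP _ a0).
  case: ifPn => [_|/emptyNPn[n]].
    by apply: IH => //; apply: avoid_lor => //; apply: avoid_sub.
  rewrite N.land_spec N.ldiff_spec => /andP[/andP[/hb sn _] /hP].
  by rewrite (negPf sn).
case: ifP => [/andP[/emptyNPn[n]]|_].
  rewrite N.land_spec N.ldiff_spec => /andP[/andP[bn _] /hP sn] a1.
  apply: IH => //; apply: below_lor => //; apply: singletonPn => // ha.
  by have := hab (avoid_ldiff hZ ha) n bn; rewrite sn.
apply: IH => // ab; rewrite mem_cat inE orbCA -mem_cat => /orP[/eqP->|/hrs'//].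
move=> ha; apply: avoid_sub; apply: hab; exact: avoid_ldiff ha.
Qed.

Lemma prune_sound Z P us out :
  avoid Z -> below P -> (forall u, u \in us ++ out -> ~ below u) ->
  if prune Z P us out is Some (Z', us') then
    avoid Z' /\ forall u, u \in us' -> ~ below u
  else False.
Proof.
elim: us Z out => [|u us IH] Z out hZ hP hus //=.
have hu : ~ below (N.ldiff u P).
  by move=> h; apply: (hus u (mem_head _ _)); apply: below_ldiff h.
have hus' v : v \in us ++ out -> ~ below v.
  by move=> h; apply: hus; rewrite inE h orbT.
case: ifP => _; first exact: IH.
case: ifPn => [u0|_]; first by apply: hu => n; rewrite (emptyNP _ u0).
case: ifPn => [u1|_].
  by apply: IH => //; apply: avoid_lor => //; apply: singleton_avoid.
by apply: IH => // v; rewrite mem_cat inE orbCA -mem_cat => /orP[/eqP->|/hus'].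
Qed.

(** Propagation and pruning preserve truth for the assignment [s], and a split covers both values of
    [s k], so a successful search excludes every such [s]. *)
Lemma refute_sound n Z P rs us :
  refute n Z P rs us -> avoid Z -> below P ->
  (forall ab, ab \in rs -> implied ab) -> ~ (forall u, u \in us -> ~ below u).
Proof.
elim: n Z P rs us => [|n IH] Z P rs us //= href hZ hP hrs hus.
have hrs0 ab : ab \in rs ++ [::] -> implied ab by rewrite cats0 => /hrs.
have := propagate_sound hZ hP hrs0.
case: propagate href => [[[Z1 P1] rs1]|//] href [hZ1 hP1 hrs1].
have hus0 u : u \in us ++ [::] -> ~ below u by rewrite cats0 => /hus.
have := prune_sound hZ1 hP1 hus0.
case: prune href => [[Z2 us2]|//] href [hZ2 hus2].
case: ifP href => [_|_ /IH]; last by apply.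
case: us2 hus2 => [//|u us2] hus2 /andP[h1 h2].
set k := N.log2 _ in h1 h2.
have bit m : N.testbit (N.shiftl 1 k) m -> k = m.
  by rewrite N.shiftl_1_l N.pow2_bits_eqb => /N.eqb_eq.
case: (boolP (s k)) => sk.
  apply: (IH _ _ _ _ h2 hZ2) hus2 => //.
  by apply: below_lor => // m /bit <-.
apply: (IH _ _ _ _ h1) hus2 => //.
by apply: avoid_lor => // m /bit <-.
Qed.

End Search.

(** * The cone of Kraus weights *)

(* (x, z) encodes the Pauli matrix X^x Z^z up to a phase, of index x + 2z. *)
Definition pt := (bool * bool)%type.
Definition vec := (pt * pt)%type.
(* (false, k) stands for the coordinate p_k, and (true, k) for q_k. *)
Definition atom := (bool * vec)%type.

Definition padd (a b : pt) : pt := (a.1 (+) b.1, a.2 (+) b.2).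
Definition vadd (a b : vec) : vec := (padd a.1 b.1, padd a.2 b.2).
Definition sp (a b : pt) : bool := (a.1 && b.2) (+) (a.2 && b.1).
Definition chi (a b : vec) : bool := sp a.1 b.1 (+) sp a.2 b.2.
Definition nz (a : pt) : bool := a.1 || a.2.
(** Over F_2, [nz] is the form x + z + xz, which polarizes to [sp]; hence [qf] is a quadratic form
    polarizing to [chi]. *)
Definition qf (a : vec) : bool := nz a.1 (+) nz a.2.

Definition p0 : pt := (false, false).
Definition v0 : vec := (p0, p0).
Definition nzpts : seq pt := [:: (true, false); (false, true); (true, true)].
Definition pts : seq pt := p0 :: nzpts.
Definition vecs : seq vec := [seq (a, b) | a <- pts, b <- pts].
Definition atoms : seq atom := [seq (f, k) | f <- [:: false; true], k <- vecs].

Definition pcode (a : pt) : nat := a.1 + 2 * a.2.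
Definition vcode (a : vec) : nat := 4 * pcode a.1 + pcode a.2.
Definition acode (k : atom) : N := N.of_nat (16 * k.1 + vcode k.2).
Definition bits (l : seq atom) : N :=
  foldr (fun k m => N.setbit m (acode k)) 0%num l.

Definition compl (l : seq pt) : seq pt := [seq a <- pts | a \notin l].
Definition block f (I J : seq pt) : seq atom :=
  [seq (f, (i, j)) | i <- I, j <- J].

(* On the 4 x 4 grid V = F_2^2 x F_2^2, with row sums r_i and column sums c_j of p
   and total t, one has q_ij = t/4 - r_i/2 - c_j/2 + p_ij.  The linear relations
   below, each equating two sums of four coordinates, turned out to be enough
   for the search to terminate. *)
Definition rect_rels : seq (seq atom * seq atom) :=
  let prs := [seq ab <- vecs | pcode ab.1 < pcode ab.2] in
  [seq let I := [:: r.1; r.2] in let J := [:: c.1; c.2] in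
       (block false I J, block true (compl I) (compl J)) | r <- prs, c <- prs].
Definition cross_rels : seq (seq atom * seq atom) :=
  [seq let: (f, (i, j)) := k in
       (block f [:: i] [:: j] ++ block (~~ f) (compl [:: i]) [:: j],
        block (~~ f) [:: i] [:: j] ++ block f [:: i] (compl [:: j]))
  | k <- atoms].
Definition mixed_rels : seq (seq atom * seq atom) :=
  let prs := [seq ab <- vecs | ab.1 != ab.2] in
  [seq let: (f, (a, b)) := k in let: (c, d) := cd in
    (block (~~ f) (compl [:: a; b]) [:: d] ++ [:: (f, (a, d)); (~~ f, (a, c))],
     [:: (f, (a, c)); (~~ f, (b, c))] ++ block f [:: b] (compl [:: c; d]))
  | k <- [seq (f, ab) | ab <- prs, f <- [:: false; true]], cd <- prs].
Definition rels := rect_rels ++ cross_rels ++ mixed_rels.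

(** The transform from p to q sends a Lagrangian coset to a coset of the same Lagrangian, with the
    values of its defining characters shifted by [qf]. *)
Definition wt (g : vec) (k : atom) : bool := (k.1 && qf g) (+) chi g k.2.
(* The p-part is a row without one cell together with the graph of a bijection
   from the other rows to the remaining columns (for [fs.1 = false]), or the
   transpose of this. *)
Definition hook (fs : bool * seq pt) : seq atom :=
  block fs.1 [:: p0] nzpts ++ block (~~ fs.1) nzpts [:: p0]
  ++ [seq (f, k) | f <- [:: false; true], k <- zip nzpts fs.2].

Definition ray := ((vec * vec) * (bool * bool) + vec * (bool * seq pt))%type.
Definition in_ray (r : ray) (k : atom) : bool :=
  match r with
  | inl (gh, ab) => (wt gh.1 k == ab.1) && (wt gh.2 k == ab.2)
  | inr (h, fs) => (k.1, vadd h k.2) \in hook fs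
  end.

(* The order constraint selects one basis of each Lagrangian subspace. *)
Definition lagr : seq (vec * vec) :=
  [seq gh <- [seq (g, h) | g <- vecs, h <- vecs] |
    [&& 0 < vcode gh.1, vcode gh.1 < vcode gh.2,
        vcode gh.2 < vcode (vadd gh.1 gh.2) & ~~ chi gh.1 gh.2]].
Definition hooks : seq (bool * seq pt) :=
  [seq (f, s) | f <- [:: false; true], s <- permutations nzpts].
Definition coset_rays : seq ray := [seq inl (gh, ab) | ab <- pts, gh <- lagr].
Definition rays : seq ray :=
  coset_rays ++ [seq inr (h, fs) | h <- vecs, fs <- hooks].
Definition is_ray (r : ray) : bool :=
  match r with inl (gh, _) => gh \in lagr | inr (_, fs) => fs \in hooks end.

Definition ray_bits (r : ray) : N := bits [seq k <- atoms | in_ray r k].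
Definition rel_bits : seq (N * N) :=
  let ms := [seq (bits r.1, bits r.2) | r <- rels] in
  ms ++ [seq (r.2, r.1) | r <- ms].

(* Translations act transitively on V, so only p_0 > 0 has to be considered. *)
Lemma refute_all :
  refute 100 0 (bits [:: (false, v0)]) rel_bits [seq ray_bits r | r <- rays].
Proof. by vm_cast_no_check (erefl true). Qed.

(* [coefp] and [coefn] are the positive and negative parts of the coefficients of
   4 p_k and 4 q_k in terms of p. *)
Definition coefp (k : atom) (a : vec) : nat :=
  if k.1 then nat_of_bool (~~ qf (vadd a k.2)) else 4 * (a == k.2).
Definition coefn (k : atom) (a : vec) : nat := k.1 && qf (vadd a k.2).

(** Equality of the coefficients of each p_a on the two sides of every relation, with negative parts
    moved across so that the check stays in [nat]. *)
Lemma rels_balanced : all (fun r : seq atom * seq atom => all (fun a =>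
    sumn [seq coefp k a | k <- r.1] + sumn [seq coefn k a | k <- r.2] ==
    sumn [seq coefp k a | k <- r.2] + sumn [seq coefn k a | k <- r.1]) vecs) rels.
Proof. by vm_cast_no_check (erefl true). Qed.

(** The q-part of each ray is the transform of its p-part: 4 q_k counts the points a of the p-part
    with [qf (vadd a k)] false, minus those with it true. Hooks are checked at the origin only. *)
Lemma rays_balanced : all (fun r => all (fun k =>
    4 * in_ray r (true, k) +
      count (fun a => in_ray r (false, a) && qf (vadd a k)) vecs ==
    count (fun a => in_ray r (false, a) && ~~ qf (vadd a k)) vecs) vecs)
  (coset_rays ++ [seq inr (v0, fs) | fs <- hooks]).
Proof. by vm_cast_no_check (erefl true). Qed.

Lemma rays_inhabited : all (fun r => has (in_ray r) atoms) rays.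
Proof. by vm_cast_no_check (erefl true). Qed.

Lemma rays_ok : all is_ray rays.
Proof. by vm_cast_no_check (erefl true). Qed.

(** * Finite enumeration and the symplectic space F_2^4 *)

Lemma mem_pts a : a \in pts.
Proof. by case: a => [[] []]. Qed.

Lemma mem_vecs a : a \in vecs.
Proof. by case: a => a b; apply: allpairs_f; apply: mem_pts. Qed.

Lemma mem_atoms k : k \in atoms.
Proof. by case: k => f a; apply: allpairs_f; [case: f|apply: mem_vecs]. Qed.

Lemma acode_inj : injective acode.
Proof.
move=> [f [[x y] [z t]]] [f' [[x' y'] [z' t']]].
by case: f x y z t f' x' y' z' t' => [] [] [] [] [] [] [] [] [] [].
Qed.

Lemma testbit_bits l n : N.testbit (bits l) n = (n \in [seq acode k | k <- l]).
Proof.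
elim: l => [|k l IH] /=; first by [].
rewrite N.setbit_eqb inE IH; congr (_ || _).
by apply/idP/eqP => [/N.eqb_eq->|->] //; apply/N.eqb_eq.
Qed.

Lemma paddA a b c : padd a (padd b c) = padd (padd a b) c.
Proof. by rewrite /padd /= !addbA. Qed.
Lemma paddC a b : padd a b = padd b a.
Proof. by rewrite /padd addbC [a.2 (+) _]addbC. Qed.
Lemma vaddA a b c : vadd a (vadd b c) = vadd (vadd a b) c.
Proof. by rewrite /vadd /= !paddA. Qed.
Lemma vaddC a b : vadd a b = vadd b a.
Proof. by rewrite /vadd paddC [padd a.2 _]paddC. Qed.
Lemma vaddK h a : vadd h (vadd h a) = a.
Proof. by case: h a => [[[] []] [[] []]] [[[] []] [[] []]]. Qed.
Lemma vaddDD h a b : vadd (vadd h a) (vadd h b) = vadd a b.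
Proof. by rewrite [vadd h a]vaddC -vaddA vaddK. Qed.
Lemma vadd0 a : vadd v0 a = a.
Proof. by case: a => [[[] []] [[] []]]. Qed.

Lemma spDr a b c : sp a (padd b c) = sp a b (+) sp a c.
Proof. by case: a b c => [[] []] [[] []] [[] []]. Qed.
Lemma chiDr g a b : chi g (vadd a b) = chi g a (+) chi g b.
Proof. by rewrite /chi /= !spDr addbACA. Qed.
Lemma spC a b : sp a b = sp b a.
Proof. by case: a b => [[] []] [[] []]. Qed.
Lemma chiC a b : chi a b = chi b a.
Proof. by rewrite /chi spC [sp a.2 _]spC. Qed.

(** * Real weights and their decomposition into extreme rays *)

Section Cone.
Variable R : realFieldType.
Local Open Scope ring_scope.

Definition sg (b : bool) : R := (-1) ^+ b.

Definition dual (p : vec -> R) (k : vec) : R :=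
  (\sum_(a : vec) sg (qf (vadd a k)) * p a) / 4.
Definition pval (p : vec -> R) (k : atom) : R :=
  if k.1 then dual p k.2 else p k.2.
Definition valid (p : vec -> R) := forall k, 0 <= pval p k.

Lemma eq_pval p p' : p =1 p' -> pval p =1 pval p'.
Proof.
move=> e [[] k]; rewrite /pval /= ?e // /dual.
by under eq_bigr do rewrite e.
Qed.

Lemma sum_vecs (F : vec -> R) : \sum_(a : vec) F a = \sum_(a <- vecs) F a.
Proof.
rewrite -big_enum /=; apply: perm_big; apply: uniq_perm => //.
  exact: enum_uniq.
by move=> a; rewrite mem_enum mem_vecs.
Qed.

Lemma natr_count (T : Type) (P : pred T) (l : seq T) :
  (count P l)%:R = \sum_(a <- l) (P a)%:R :> R.
Proof. by rewrite -sumn_count sumnE big_map natr_sum. Qed.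

Lemma pval_coef p k :
  4 * pval p k = \sum_(a : vec) ((coefp k a)%:R - (coefn k a)%:R) * p a.
Proof.
case: k => [[] k]; rewrite /pval /coefp /coefn /=.
  rewrite /dual mulrC divfK ?pnatr_eq0 //; apply: eq_bigr => a _; congr (_ * _).
  by case: (qf _); rewrite /sg ?expr1 ?expr0 ?subr0 ?sub0r.
rewrite (bigD1 k) //= eqxx muln1 subr0 big1 ?addr0 // => a /negPf->.
by rewrite muln0 subr0 mul0r.
Qed.

Lemma rels_hold p ab : ab \in rels ->
  \sum_(k <- ab.1) pval p k = \sum_(k <- ab.2) pval p k.
Proof.
move=> /(allP rels_balanced) /allP bal.
have h4 : 4 != 0 :> R by rewrite pnatr_eq0.
apply: (mulfI h4); rewrite !mulr_sumr.
(* One side is expanded in the values of [p] and the sums are exchanged; [symmetry] then brings up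
   the other side for the same treatment. *)
do 2![under eq_bigr do rewrite pval_coef; rewrite exchange_big /=; symmetry].
apply: eq_bigr => a _; rewrite -!mulr_suml; congr (_ * _).
have /eqP := bal a (mem_vecs a); rewrite !sumnE !big_map => /(congr1 (fun n => n%:R : R)).
rewrite !natrD !natr_sum !sumrB => e; apply/eqP; rewrite subr_eq; apply/eqP.
by rewrite addrAC -e addrK.
Qed.

Definition supp p (n : N) : bool := has (fun k => (acode k == n) && (0 < pval p k)) atoms.

Lemma supp_acode p k : supp p (acode k) = (0 < pval p k).
Proof.
apply/hasP/idP => [[k' _ /andP[/eqP/acode_inj->]]//|h].
by exists k; rewrite ?mem_atoms ?eqxx.
Qed.

(** Nonnegative terms vanish together exactly when their sum does; this turns each linear relation
    into implications between supports, in both directions. *)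
Lemma avoid_bits p l : valid p ->
  avoid (supp p) (bits l) <-> \sum_(k <- l) pval p k = 0.
Proof.
move=> vp; split => [h|/eqP].
  rewrite big_seq big1 // => k kl.
  have : ~~ supp p (acode k) by apply: h; rewrite testbit_bits map_f.
  by rewrite supp_acode -leNgt => h'; apply/eqP; rewrite eq_le h' vp.
rewrite psumr_eq0 // => /allP h n.
rewrite testbit_bits => /mapP[k /h /= /eqP vk ->].
by rewrite supp_acode vk ltxx.
Qed.

Lemma below_bits p (P : pred atom) :
  below (supp p) (bits [seq k <- atoms | P k]) <-> forall k, P k -> 0 < pval p k.
Proof.
split=> [h k Pk|h n].
  rewrite -supp_acode; apply: h; rewrite testbit_bits map_f // mem_filter Pk.
  exact: mem_atoms.
by rewrite testbit_bits => /mapP[k]; rewrite mem_filter => /andP[/h h' _] ->; rewrite supp_acode.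
Qed.

(** If no ray lay in the support, the pattern [supp p] would satisfy all the implications and
    exclusions refuted by [refute_all]. *)
Lemma ray_in_support0 p : valid p -> 0 < p v0 ->
  exists2 r, r \in rays & forall k, in_ray r k -> 0 < pval p k.
Proof.
move=> vp pos.
case: (boolP (has (fun r => all (fun k => in_ray r k ==> (0 < pval p k)) atoms) rays)).
  case/hasP => r rr /allP h; exists r => // k kr.
  by have := h k (mem_atoms k); rewrite kr.
move/hasPn => none; exfalso.
apply: (refute_sound (s := supp p) refute_all).
- by move=> n; rewrite N.bits_0.
- by move=> n; rewrite testbit_bits inE => /eqP ->; rewrite supp_acode.
- move=> ab; rewrite mem_cat => h.
  suff e : exists l1 l2, [/\ ab.1 = bits l1, ab.2 = bits l2 &
      \sum_(k <- l1) pval p k = \sum_(k <- l2) pval p k].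
    case: e => l1 [l2 [e1 e2 e]]; rewrite /implied e1 e2.
    by rewrite !(avoid_bits _ vp) e.
  case/orP: h => [/mapP[r rr ->]|/mapP[_ /mapP[r rr ->] ->]] /=.
    by exists r.1, r.2; split => //; exact: rels_hold.
  by exists r.2, r.1; split => //; symmetry; exact: rels_hold.
- move=> _ /mapP[r rr ->] /below_bits h.
  case/negP: (none r rr); apply/allP => k _; apply/implyP; exact: h.
Qed.

Definition translate h (p : vec -> R) : vec -> R := fun k => p (vadd h k).

Lemma pval_translate h p k : pval (translate h p) k = pval p (k.1, vadd h k.2).
Proof.
case: k => [[] k] //=; rewrite /pval /= /dual; congr (_ / _).
rewrite [RHS](reindex (vadd h)) /=; last by exists (vadd h) => a _; rewrite vaddK.
by apply: eq_bigr => a _; rewrite vaddDD.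
Qed.

Definition ray_translate h (r : ray) : ray :=
  match r with
  | inl (gh, ab) => inl (gh, (ab.1 (+) chi gh.1 h, ab.2 (+) chi gh.2 h))
  | inr (h', fs) => inr (vadd h h', fs)
  end.

Lemma in_ray_translate h r k :
  in_ray (ray_translate h r) k = in_ray r (k.1, vadd h k.2).
Proof.
case: r => [[[g1 g2] [a b]]|[h' fs]] /=; last by rewrite vaddA [vadd h' h]vaddC.
by rewrite /wt /= !chiDr; case: (_ && _) (_ && _) (chi _ _) (chi _ _) (chi _ _) (chi _ _) a b
  => [] [] [] [] [] [] [] [].
Qed.

Lemma is_ray_translate h r : is_ray (ray_translate h r) = is_ray r.
Proof. by case: r => [[gh ab]|[h' fs]]. Qed.

Lemma ray_in_support p h : valid p -> 0 < p h ->
  exists r, [/\ is_ray r, exists k, in_ray r k & forall k, in_ray r k -> 0 < pval p k].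
Proof.
move=> vp pos.
have [||r rr sr] := @ray_in_support0 (translate h p).
- by move=> k; rewrite pval_translate.
- by rewrite /translate vaddC vadd0.
have tr k : in_ray (ray_translate h r) (k.1, vadd h k.2) = in_ray r k.
  by rewrite in_ray_translate /= vaddK; case: k.
exists (ray_translate h r); split.
- by rewrite is_ray_translate (allP rays_ok).
- have /hasP[k _ kr] := allP rays_inhabited r rr.
  by exists (k.1, vadd h k.2); rewrite tr.
- move=> [f k]; rewrite in_ray_translate /= => /sr.
  by rewrite pval_translate /= vaddK.
Qed.

Definition indicator (r : ray) (k : vec) : R := (in_ray r (false, k))%:R.

Lemma pval_indicator r k : is_ray r -> pval (indicator r) k = (in_ray r k)%:R.
Proof.
(* A hook at [h] is the translate of the hook at [v0], and [dual] commutes with translations. *)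
wlog rb : r k / r \in coset_rays ++ [seq inr (v0, fs) | fs <- hooks].
  move=> hw; case: r => [[gh ab]|[h fs]] hr.
    apply: hw => //; rewrite mem_cat; apply/orP; left.
    by apply/allpairsP; exists (ab, gh); rewrite mem_pts.
  have e : indicator (inr (h, fs)) =1 translate h (indicator (inr (v0, fs))).
    by move=> a; rewrite /indicator /translate /= vadd0.
  rewrite (eq_pval e).
  by rewrite pval_translate hw.
move=> hr; case: k => [[] k] //; rewrite /pval /= /dual sum_vecs.
have /eqP := allP (allP rays_balanced r rb) k (mem_vecs k).
move/(congr1 (fun n => n%:R : R)); rewrite natrD natrM => e.
apply: (mulIf (x := 4)); first by rewrite pnatr_eq0.
rewrite divfK ?pnatr_eq0 // mulrC -[RHS](addrK (count (fun a => in_ray r (false, a) && qf (vadd a k)) vecs)%:R) e.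
rewrite !natr_count -sumrB; apply: eq_bigr => a _.
rewrite /indicator /sg; case: (in_ray r _); case: (qf _); rewrite /= ?expr0 ?expr1 /=; ring.
Qed.

Lemma pval_sub p r t k : is_ray r ->
  pval (fun a => p a - t * indicator r a) k = pval p k - t * (in_ray r k)%:R.
Proof.
move=> hr; rewrite -(pval_indicator k hr); case: k => [[] k] //; rewrite /pval /= /dual.
rewrite mulrA -mulrBl mulr_sumr -sumrB; congr (_ / _).
by apply: eq_bigr => a _; ring.
Qed.

(** Induction on the number of positive coordinates among all p_k and q_k, peeling off a multiple of
    a ray contained in the support. *)
Lemma cone_decomposition p : valid p ->
  exists2 l : seq (R * ray), all (fun c => (0 <= c.1) && is_ray c.2) l &
    forall k, p k = \sum_(c <- l) c.1 * indicator c.2 k.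
Proof.
have [n] := ubnP #|[pred k | 0 < pval p k]|; elim: n p => // n IH p hn vp.
case: (boolP [exists h, 0 < p h]) => [/existsP[h ph]|/existsPn p_le0]; last first.
  exists [::] => // k; rewrite big_nil; apply/eqP; rewrite eq_le leNgt p_le0.
  exact: (vp (false, k)).
have [r [hr [k0 k0r] sr]] := ray_in_support vp ph.
case: (@arg_minP _ _ _ k0 (in_ray r) (pval p) k0r) => k1 k1r k1min.
(* The minimum over the ray is the largest multiple that can be subtracted without leaving the cone,
   and it makes the coordinate [k1] vanish. *)
pose t := pval p k1.
have tpos : 0 < t by apply: sr.
have [||l lr le] := IH (fun a => p a - t * indicator r a).
- rewrite ltnS in hn; apply: leq_trans hn.
  apply: proper_card; apply/properP; split.
    apply/subsetP => k; rewrite !inE pval_sub //; case: (in_ray r k); last by rewrite mulr0 subr0.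
    by rewrite mulr1 subr_gt0; apply: lt_trans.
  by exists k1; rewrite !inE ?pval_sub // k1r mulr1 subrr ltxx.
- move=> k; rewrite pval_sub //; case: (boolP (in_ray r k)) => [/k1min|_].
    by rewrite mulr1 subr_ge0.
  by rewrite mulr0 subr0.
exists ((t, r) :: l); first by rewrite /= ltW // hr.
by move=> k; rewrite big_cons -le /= addrC subrK.
Qed.

End Cone.

(** * Convolution of extreme rays *)

(** The value at [k] of the convolution of the two p-parts, since subtraction and addition coincide
    on F_2^4. *)
Definition conv_count (r s : ray) (k : vec) : nat :=
  count (fun a => in_ray r (false, a) && in_ray s (false, vadd a k)) vecs.

Definition coset_table : seq (ray * bitseq) :=
  [seq (t, [seq in_ray t (false, k) | k <- vecs]) | t <- coset_rays].

(** A coset through an exhausted cell scores 0, so the truncated subtraction in [coset_cover] never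
    truncates on a chosen coset. *)
Definition coset_score (ns : seq nat) (b : bitseq) : nat :=
  let v := mask b ns in if 0 \in v then 0 else sumn v.

(* Repeatedly removing a coset of largest mass happens to work for all products of
   hooks, but this depends on the order of [coset_rays], which breaks the ties. *)
Fixpoint coset_cover (fuel : nat) (ns : seq nat) : seq ray :=
  if fuel is n.+1 then
    let best := foldl (fun acc tb => let c := coset_score ns tb.2 in
                  if acc.1 < c then (c, tb) else acc)
                (0, (inr (v0, (false, [::])), [::])) coset_table in
    if best.1 == 0 then [::]
    else best.2.1 :: coset_cover n [seq x.1 - nat_of_bool x.2 | x <- zip ns best.2.2]
  else [::].

(** The fuel 9 is the mass 36 of a product of two hooks divided by the size 4 of a coset. *)
Definition conv_cover (r s : ray) : seq ray :=
  coset_cover 9 [seq conv_count r s k | k <- vecs].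

(** The greedy output is treated as a certificate and verified cell by cell, so nothing has to be
    proved about the greedy search. *)
Definition conv_decomposes (r s : ray) : bool :=
  let l := conv_cover r s in
  all (mem coset_rays) l &&
  all (fun k => conv_count r s k == count (fun t => in_ray t (false, k)) l) vecs.

Lemma hook_conv :
  all (fun x => all (fun y => conv_decomposes (inr (v0, x)) (inr (v0, y))) hooks) hooks.
Proof. by vm_cast_no_check (erefl true). Qed.

(** * Fourier transform on F_2^4 and the cone of stabilizer signs *)

Section StabCone.
Variable R : realFieldType.
Local Open Scope ring_scope.
Notation sg := (@sg R).

Lemma sgD a b : sg (a (+) b) = sg a * sg b.
Proof. by rewrite /sg signr_addb. Qed.

Lemma sg2 a : sg a * sg a = 1.
Proof. by rewrite -sgD addbb. Qed.

Lemma chi0r g : chi g v0 = false.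
Proof. by case: g => [[[] []] [[] []]]. Qed.

Lemma chiDl g h k : chi (vadd g h) k = chi g k (+) chi h k.
Proof. by rewrite !(chiC _ k) chiDr. Qed.

Lemma chi_nondegenerate g : g != v0 -> exists h, chi g h.
Proof.
case: g => [[[] []] [[] []]] // _; try by exists ((false, true), p0).
all: try by exists ((true, false), p0).
all: try by exists (p0, (false, true)).
by exists (p0, (true, false)).
Qed.

Lemma sum_sg g : \sum_(k : vec) sg (chi g k) = 16 * (g == v0)%:R.
Proof.
have [->|g0] := eqVneq g v0.
  under eq_bigr do rewrite chiC chi0r /sg expr0.
  by rewrite sumr_const !card_prod card_bool mulr1.
have [h gh] := chi_nondegenerate g0.
(* Translation by an [h] with [chi g h] true flips the sign of every term. *)
set S := LHS; have e : S = - S.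
  rewrite {1}/S (reindex (vadd h)) /=; last by exists (vadd h) => a _; rewrite vaddK.
  rewrite -sumrN; apply: eq_bigr => k _.
  by rewrite chiDr gh /sg; case: (chi g k); rewrite /= ?expr0 ?expr1 ?opprK.
rewrite mulr0; lra.
Qed.

Lemma vadd_eq0 g h : (vadd g h == v0) = (g == h).
Proof. by case: g h => [[[] []] [[] []]] [[[] []] [[] []]]. Qed.

Definition fourier (p : vec -> R) (g : vec) : R := \sum_(k : vec) sg (chi g k) * p k.

Lemma fourier_ext p p' : p =1 p' -> fourier p =1 fourier p'.
Proof. by move=> e g; apply: eq_bigr => k _; rewrite e. Qed.

Lemma fourierK p g : fourier (fourier p) g = 16 * p g.
Proof.
rewrite /fourier; under eq_bigr do rewrite mulr_sumr.
rewrite exchange_big /= (bigD1 g) //= [X in _ + X]big1 => [|h hg].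
  rewrite addr0 -[RHS]mulr1 -mulrA mulrC; under eq_bigr do rewrite mulrA chiC sg2 mul1r.
  by rewrite sumr_const !card_prod card_bool -[p g *+ _]mulr_natl mulr1 mulrC.
under eq_bigr do rewrite mulrA [chi _ h]chiC -sgD -chiDl.
by rewrite -mulr_suml sum_sg vadd_eq0 eq_sym (negPf hg) mulr0 mul0r.
Qed.

(* Stabilizer signs: (1 + (-1)^a [g]) (1 + (-1)^b [h]) in the group algebra. *)
Definition stab (g h : vec) (a b : bool) (x : vec) : R :=
  (x == v0)%:R + sg a * (x == g)%:R + sg b * (x == h)%:R
  + sg (a (+) b) * (x == vadd g h)%:R.

(** The indicator is a product of two factors (1 ± character)/2; expanding it leaves four character
    sums, evaluated by orthogonality. *)
Lemma fourier_coset g h a b x :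
  fourier (indicator R (inl (g, h, (a, b)))) x = 4 * stab g h a b x.
Proof.
have e k : indicator R (inl (g, h, (a, b))) k =
    (1 + sg a * sg (chi g k)) * (1 + sg b * sg (chi h k)) / 4.
  rewrite /indicator /in_ray /wt /=.
  by case: (chi g k) (chi h k) a b => [] [] [] []; rewrite /sg /= ?expr0 ?expr1; field.
have sc g' : \sum_(k : vec) sg (chi x k) * sg (chi g' k) = 16 * (x == g')%:R.
  by under eq_bigr do rewrite -sgD -chiDl; rewrite sum_sg vadd_eq0.
transitivity ((\sum_(k : vec) sg (chi x k)
   + sg a * (\sum_(k : vec) sg (chi x k) * sg (chi g k))
   + sg b * (\sum_(k : vec) sg (chi x k) * sg (chi h k))
   + sg (a (+) b) * (\sum_(k : vec) sg (chi x k) * sg (chi (vadd g h) k))) / 4).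
  rewrite !mulr_sumr -!big_split /= mulr_suml; apply: eq_bigr => k _.
  by rewrite e chiDl !sgD; field.
by rewrite !sc sum_sg /stab; field.
Qed.

(** The convex cone generated by the stabilizer signs of commuting pairs; [StabExt] stands in for
    functional extensionality. *)
Inductive stab_cone : (vec -> R) -> Prop :=
| StabGen g h a b : chi g h = false -> stab_cone (stab g h a b)
| StabZero : stab_cone (fun=> 0)
| StabAdd m m' : stab_cone m -> stab_cone m' -> stab_cone (fun x => m x + m' x)
| StabScale c m : 0 <= c -> stab_cone m -> stab_cone (fun x => c * m x)
| StabExt m m' : m =1 m' -> stab_cone m -> stab_cone m'.

Lemma stab_cone_sum (T : eqType) (l : seq T) (F : T -> vec -> R) :
  (forall t, t \in l -> stab_cone (F t)) ->
  stab_cone (fun x => \sum_(t <- l) F t x).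
Proof.
elim: l => [|t l IH] h.
  by apply: StabExt StabZero => x; rewrite big_nil.
apply: (@StabExt (fun x => F t x + \sum_(t <- l) F t x)).
  by move=> x; rewrite big_cons.
apply: StabAdd; first by apply: h; rewrite mem_head.
by apply: IH => u ul; apply: h; rewrite inE ul orbT.
Qed.

(** The Fourier side of translation by [h]: a stabilizer sign pattern keeps its group and only
    changes the signs [a] and [b]. *)
Lemma stab_cone_twist h m : stab_cone m -> stab_cone (fun x => sg (chi x h) * m x).
Proof.
elim=> {m} [g g' a b gg'||m m' _ IH _ IH'|c m c0 _ IH|m m' e _ IH].
- apply: StabExt (StabGen (a (+) chi g h) (b (+) chi g' h) gg') => x.
  rewrite /stab !mulrDr; congr (_ + _ + _ + _).
  + by case: eqP => [->|_]; rewrite ?mulr0 // chiC chi0r /sg expr0 mul1r.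
  + by case: eqP => [->|_]; rewrite ?mulr0 // sgD; ring.
  + by case: eqP => [->|_]; rewrite ?mulr0 // sgD; ring.
  + by case: eqP => [->|_]; rewrite ?mulr0 // chiDl !sgD; ring.
- by apply: StabExt StabZero => x; rewrite mulr0.
- by apply: StabExt (StabAdd IH IH') => x; rewrite mulrDr.
- by apply: StabExt (StabScale c0 IH) => x; rewrite mulrCA.
- by apply: StabExt IH => x; rewrite e.
Qed.

Lemma lagr_isotropic gh : gh \in lagr -> chi gh.1 gh.2 = false.
Proof. by rewrite mem_filter => /andP[/and4P[_ _ _ /negPf->]]. Qed.

Lemma stab_cone_coset r : r \in coset_rays -> stab_cone (fourier (indicator R r)).
Proof.
case/allpairsP=> [[[a b] [g h]]] /= [_ gh ->].
apply: (@StabExt (fun x => 4 * stab g h a b x)).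
  by move=> x; rewrite fourier_coset.
by apply: StabScale => //; apply: StabGen; apply: (lagr_isotropic gh).
Qed.

(** The Fourier side of convolving with nonnegative weights: the product is a nonnegative
    combination of twists of [m]. *)
Lemma stab_cone_mul_fourier m p : stab_cone m -> (forall k, 0 <= p k) ->
  stab_cone (fun x => m x * fourier p x).
Proof.
move=> hm hp.
apply: (@StabExt (fun x => \sum_(k <- vecs) p k * (sg (chi x k) * m x))).
  move=> x; rewrite /fourier sum_vecs mulr_sumr; apply: eq_bigr => k _; ring.
by apply: stab_cone_sum => k _; apply: StabScale => //; apply: stab_cone_twist.
Qed.

Lemma fourier_conv r s x :
  fourier (indicator R r) x * fourier (indicator R s) x =
  fourier (fun k => (conv_count r s k)%:R) x.
Proof.
rewrite /fourier mulr_suml.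
under [RHS]eq_bigr => k _ do rewrite /conv_count natr_count -sum_vecs mulr_sumr.
rewrite exchange_big /=; apply: eq_bigr => a _.
rewrite mulr_sumr [LHS](reindex (vadd a)) /=; last by exists (vadd a) => b _; rewrite vaddK.
apply: eq_bigr => k _; rewrite chiDr sgD /indicator.
by case: (in_ray r _) (in_ray s _) => [] []; rewrite /= ?(mulr1, mulr0, mul0r) // mulrA sg2 mul1r.
Qed.

Lemma fourier_hook h fs x : fourier (indicator R (inr (h, fs))) x =
  sg (chi x h) * fourier (indicator R (inr (v0, fs))) x.
Proof.
rewrite /fourier mulr_sumr (reindex (vadd h)) /=; last first.
  by exists (vadd h) => a _; rewrite vaddK.
by apply: eq_bigr => k _; rewrite chiDr sgD /indicator /= vaddK vadd0 mulrA.
Qed.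

Lemma stab_cone_hooks fs fs' : fs \in hooks -> fs' \in hooks ->
  stab_cone (fun x => fourier (indicator R (inr (v0, fs))) x * fourier (indicator R (inr (v0, fs'))) x).
Proof.
move=> /(allP hook_conv) /allP h /h {h} /=.
set r : ray := inr (v0, fs); set s : ray := inr (v0, fs').
rewrite /conv_decomposes; set l := conv_cover r s => /andP[/allP lc /allP hk].
have e k : (conv_count r s k)%:R = \sum_(t <- l) indicator R t k :> R.
  by rewrite (eqP (hk k (mem_vecs k))) natr_count.
apply: (@StabExt (fun x => \sum_(t <- l) fourier (indicator R t) x)).
  move=> x; rewrite fourier_conv (fourier_ext e) /fourier.
  by rewrite exchange_big /=; apply: eq_bigr => k _; rewrite mulr_sumr.
by apply: stab_cone_sum => t /lc; apply: stab_cone_coset.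
Qed.

Lemma stab_cone_rays r s : is_ray r -> is_ray s ->
  stab_cone (fun x => fourier (indicator R r) x * fourier (indicator R s) x).
Proof.
have ge0 t k : 0 <= indicator R t k by rewrite /indicator ler0n.
have cos gh ab : is_ray (inl (gh, ab)) -> inl (gh, ab) \in coset_rays.
  by move=> hgh; apply/allpairsP; exists (ab, gh); rewrite mem_pts.
case: r s => [[gh ab]|[h fs]] [[gh' ab']|[h' fs']] hr hs.
- by apply: stab_cone_mul_fourier => //; apply: stab_cone_coset; apply: cos.
- by apply: stab_cone_mul_fourier => //; apply: stab_cone_coset; apply: cos.
- apply: (@StabExt (fun x => fourier (indicator R (inl (gh', ab'))) x * fourier (indicator R (inr (h, fs))) x)).
    by move=> x; rewrite mulrC.
  by apply: stab_cone_mul_fourier => //; apply: stab_cone_coset; apply: cos.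
(* The translations of both hooks factor out as twists, leaving two hooks at the origin. *)
- have := stab_cone_twist h (stab_cone_twist h' (stab_cone_hooks hr hs)).
  by apply: StabExt => x; rewrite (fourier_hook h fs) (fourier_hook h' fs'); ring.
Qed.

Lemma stab_cone_mul p q : valid p -> valid q ->
  stab_cone (fun x => fourier p x * fourier q x).
Proof.
have F p' l : (forall k, p' k = \sum_(c <- l) c.1 * indicator R c.2 k) ->
    forall x, fourier p' x = \sum_(c <- l) c.1 * fourier (indicator R c.2) x.
  move=> e x; rewrite (fourier_ext e) /fourier.
  under eq_bigr do rewrite mulr_sumr.
  rewrite exchange_big /=; apply: eq_bigr => c _; rewrite mulr_sumr.
  by apply: eq_bigr => k _; rewrite mulrCA.
move=> /cone_decomposition[l /allP hl /F lp] /cone_decomposition[l' /allP hl' /F lq].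
apply: (@StabExt (fun x => \sum_(c <- l) \sum_(d <- l')
   (c.1 * d.1) * (fourier (indicator R c.2) x * fourier (indicator R d.2) x))).
  move=> x; rewrite lp lq mulr_suml; apply: eq_bigr => c _.
  by rewrite mulr_sumr; apply: eq_bigr => d _; ring.
apply: stab_cone_sum => c /hl /andP[c0 cr]; apply: stab_cone_sum => d /hl' /andP[d0 dr].
by apply: StabScale; [apply: mulr_ge0|apply: stab_cone_rays].
Qed.

Lemma sum_pts (F : pt -> R) : \sum_(a : pt) F a =
  F (true, true) + F (true, false) + F (false, true) + F (false, false).
Proof.
transitivity (\sum_(x : bool) \sum_(y : bool) F (x, y)).
  by rewrite pair_bigA; apply: eq_bigr => -[].
by rewrite !big_bool /= !addrA.
Qed.

(** A Gauss sum: it factors over the two qubits, each contributing -2 times its own sign. *)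
Lemma sum_qf g : \sum_(a : vec) sg (qf a) * sg (chi a g) = 4 * sg (qf g).
Proof.
have half b : \sum_(a : pt) sg (nz a) * sg (sp a b) = - 2 * sg (nz b).
  by rewrite sum_pts; case: b => [[] []]; rewrite /sg /= !expr0 !expr1; ring.
transitivity ((\sum_(a : pt) sg (nz a) * sg (sp a g.1)) *
              (\sum_(b : pt) sg (nz b) * sg (sp b g.2))).
  rewrite big_distrlr pair_bigA /=; apply: eq_bigr => -[a b] _ /=.
  by rewrite /qf /chi !sgD mulrACA.
by rewrite !half /qf sgD; ring.
Qed.

(** [dual] is convolution with the sign of [qf], up to the factor 4. By [sum_qf] it acts on the
    multipliers as multiplication by that same sign. *)
Lemma dual_fourier mu k :
  dual (fourier mu) k = \sum_(g : vec) sg (qf g (+) chi k g) * mu g.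
Proof.
rewrite /dual /fourier; under eq_bigr do rewrite mulr_sumr.
rewrite exchange_big /= mulr_suml; apply: eq_bigr => g _.
rewrite (reindex (vadd k)) /=; last by exists (vadd k) => a _; rewrite vaddK.
transitivity (sg (chi k g) * (\sum_(a : vec) sg (qf a) * sg (chi a g)) * mu g / 4).
  congr (_ / _); rewrite mulr_sumr mulr_suml; apply: eq_bigr => a _.
  by rewrite [vadd (vadd k a) k]vaddC vaddK chiDl sgD; ring.
by rewrite sum_qf sgD; field.
Qed.

End StabCone.

Local Open Scope ring_scope.

(** * Separability *)

Section Matrices.
Variable C : numClosedFieldType.

Definition conjmx {m n} (A : 'M[C]_(m, n)) := map_mx Num.conj A.

Lemma conjmxK m n (A : 'M[C]_(m, n)) : conjmx (conjmx A) = A.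
Proof. by apply/matrixP => i j; rewrite !mxE conjCK. Qed.

Lemma conjmx_mul m n p (A : 'M[C]_(m, n)) (B : 'M[C]_(n, p)) :
  conjmx (A *m B) = conjmx A *m conjmx B.
Proof. exact: map_mxM. Qed.

Lemma adjmx_conj m n (A : 'M[C]_(m, n)) : adjmx (conjmx A) = A^T.
Proof. by rewrite /adjmx -/(conjmx _) conjmxK. Qed.

Lemma adjmxK m n (A : 'M[C]_(m, n)) : adjmx (adjmx A) = A.
Proof. by apply/matrixP => i j; rewrite !mxE conjCK. Qed.

Lemma adjmx_mul m n p (A : 'M[C]_(m, n)) (B : 'M[C]_(n, p)) :
  adjmx (A *m B) = adjmx B *m adjmx A.
Proof. by rewrite /adjmx map_mxM trmx_mul. Qed.

Lemma adjmxD m n (A B : 'M[C]_(m, n)) : adjmx (A + B) = adjmx A + adjmx B.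
Proof. by rewrite /adjmx map_mxD linearD. Qed.

Lemma adjmxZ m n c (A : 'M[C]_(m, n)) : adjmx (c *: A) = c^* *: adjmx A.
Proof. by rewrite /adjmx map_mxZ linearZ. Qed.

Lemma adjmx1 n : adjmx (1%:M : 'M[C]_n) = 1%:M.
Proof. by rewrite /adjmx map_mx1 trmx1. Qed.

Lemma psd_gram m n (M : 'M[C]_(m, n)) : psdmx (adjmx M *m M).
Proof.
split=> [|v]; first by rewrite adjmx_mul adjmxK.
rewrite mulmxA -adjmx_mul -mulmxA mxE; apply: sumr_ge0 => k _.
by rewrite !mxE mulrC mul_conjC_ge0.
Qed.

Lemma psdZ n c (A : 'M[C]_n) : 0 <= c -> psdmx A -> psdmx (c *: A).
Proof.
move=> c0 [hA pA]; split=> [|v]; first by rewrite adjmxZ hA geC0_conj.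
by rewrite -scalemxAr -scalemxAl mxE mulr_ge0.
Qed.

Lemma separable_tens d1 d2 (A : 'M[C]_d1) (B : 'M[C]_d2) :
  psdmx A -> psdmx B -> separable (A *t B).
Proof.
move=> hA hB; exists 1, (fun=> A), (fun=> B); split=> //.
by rewrite big_ord_recl big_ord0 addr0.
Qed.

Lemma separable0 d1 d2 : separable (0 : 'M[C]_(d1 * d2)).
Proof.
by exists 0, (fun=> 0), (fun=> 0); split=> [[]//|]; rewrite big_ord0.
Qed.

Lemma separableD d1 d2 (M N : 'M[C]_(d1 * d2)) :
  separable M -> separable N -> separable (M + N).
Proof.
move=> [m [A [B [hAB ->]]]] [n [A' [B' [hAB' ->]]]].
pose F T (f : 'I_m -> T) (g : 'I_n -> T) k :=
  match split k with inl i => f i | inr j => g j end.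
exists (m + n), (F _ A A'), (F _ B B'); split=> [k|].
  by rewrite /F; case: split.
by rewrite big_split_ord /=; congr (_ + _); apply: eq_bigr => k _;
  rewrite /F ?(unsplitK (inl k)) ?(unsplitK (inr k)).
Qed.

Lemma separableZ d1 d2 c (M : 'M[C]_(d1 * d2)) :
  0 <= c -> separable M -> separable (c *: M).
Proof.
move=> c0 [m [A [B [hAB ->]]]]; exists m, (fun k => c *: A k), B; split=> [k|].
  by have [hA hB] := hAB k; split=> //; apply: psdZ.
rewrite scaler_sumr; apply: eq_bigr => k _.
by apply/matrixP => i j; rewrite !mxE mulrA.
Qed.

Lemma tensmxDl m n p q (A A' : 'M[C]_(m, n)) (B : 'M[C]_(p, q)) :
  (A + A') *t B = A *t B + A' *t B.
Proof. by apply/matrixP => i j; rewrite !mxE mulrDl. Qed.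

Lemma tensmxDr m n p q (A : 'M[C]_(m, n)) (B B' : 'M[C]_(p, q)) :
  A *t (B + B') = A *t B + A *t B'.
Proof. by apply/matrixP => i j; rewrite !mxE mulrDr. Qed.

Lemma adjmx_tens m n p q (A : 'M[C]_(m, n)) (B : 'M[C]_(p, q)) :
  adjmx (A *t B) = adjmx A *t adjmx B.
Proof. by apply/matrixP => i j; rewrite !mxE rmorphM. Qed.

Lemma tensmx11 m n : (1%:M : 'M[C]_m) *t (1%:M : 'M[C]_n) = 1%:M.
Proof.
apply/matrixP => i j; case: (mxtens_indexP i) => a b; case: (mxtens_indexP j) => c d.
by rewrite tensmxE !mxE (can_eq (@mxtens_indexK m n)) -natrM mulnb.
Qed.

Lemma tensmxZ m n p q c d (A : 'M[C]_(m, n)) (B : 'M[C]_(p, q)) :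
  (c *: A) *t (d *: B) = (c * d) *: (A *t B).
Proof. by apply/matrixP => i j; rewrite !mxE mulrACA. Qed.

Definition hermitian_involution n (A : 'M[C]_n) := adjmx A = A /\ A *m A = 1%:M.

Lemma hermitian_involution_conj n (A : 'M[C]_n) :
  hermitian_involution A -> hermitian_involution (conjmx A).
Proof.
move=> [hA A2]; split.
  by rewrite adjmx_conj -{1}hA /adjmx trmxK.
by rewrite -conjmx_mul A2 /conjmx map_mx1.
Qed.

Lemma hermitian_involution_sign n (A : 'M[C]_n) (s : bool) :
  hermitian_involution A -> hermitian_involution ((-1) ^+ s *: A).
Proof.
move=> [hA A2]; split; first by rewrite adjmxZ hA rmorphXn /= rmorphN1.
by rewrite -scalemxAl -scalemxAr scalerA -signr_addb addbb expr0 scale1r.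
Qed.

(** Each factor satisfies X^2 = 2X and is Hermitian, and the two commute; so their product M equals
    M^* M / 4. *)
Lemma psd_one_plus n (A B : 'M[C]_n) :
  hermitian_involution A -> hermitian_involution B -> A *m B = B *m A ->
  psdmx ((1%:M + A) *m (1%:M + B)).
Proof.
move=> [hA A2] [hB B2] AB; set P := _ + A; set Q := _ + B.
have sq (X : 'M[C]_n) : X *m X = 1%:M -> (1%:M + X) *m (1%:M + X) = 2 *: (1%:M + X).
  move=> X2; rewrite mulmxDl !mulmxDr !mul1mx !mulmx1 X2.
  by rewrite [X + 1%:M]addrC scaler_nat mulr2n.
have adj (X : 'M[C]_n) : adjmx X = X -> adjmx (1%:M + X) = 1%:M + X.
  by move=> hX; rewrite adjmxD adjmx1 hX.
have PQ : P *m Q = Q *m P.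
  by rewrite /P /Q !mulmxDl !mulmxDr !mul1mx !mulmx1 AB !addrA [_ + A + B]addrAC.
have -> : P *m Q = 4^-1 *: (adjmx (P *m Q) *m (P *m Q)).
  rewrite adjmx_mul !adj // -/P -/Q -mulmxA [P *m (P *m _)]mulmxA sq // -/P.
  rewrite -scalemxAl -scalemxAr PQ mulmxA sq // -/Q -scalemxAl !scalerA.
  by rewrite -[LHS]scale1r; congr (_ *: _); field.
by apply: psdZ (psd_gram _); rewrite invr_ge0 ler0n.
Qed.

(** Up to a scalar this is the Choi matrix of a measure-and-prepare map: [s] and [t] are the
    outcomes of measuring the commuting [A] and [B], and the prepared state has outcomes shifted by
    [a] and [b]. *)
Lemma separable_stabilizer n (A B : 'M[C]_n) :
  hermitian_involution A -> hermitian_involution B -> A *m B = B *m A ->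
  forall a b : bool, separable ((1%:M + (-1) ^+ a *: (conjmx A *t A)) *m
             (1%:M + (-1) ^+ b *: (conjmx B *t B))).
Proof.
move=> hA hB AB a b.
(* Summing over [s] cancels the terms linear in [conjmx X] or in [X] alone and doubles the other
   two. *)
have sum (e : bool) (X : 'M[C]_n) : 2 *: (1%:M + (-1) ^+ e *: (conjmx X *t X)) =
    \sum_(s : bool) (1%:M + (-1) ^+ s *: conjmx X) *t (1%:M + (-1) ^+ (s (+) e) *: X).
  rewrite big_bool /= !expr0 expr1 !scale1r scaleN1r !tensmxDl !tensmxDr tensmx11.
  apply/matrixP => i j; rewrite !mxE.
  by case: e; rewrite /= ?expr0 ?expr1; ring.
have -> : (1%:M + (-1) ^+ a *: (conjmx A *t A)) *m (1%:M + (-1) ^+ b *: (conjmx B *t B))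
   = 4^-1 *: \sum_(s : bool) \sum_(t : bool)
      (((1%:M + (-1) ^+ s *: conjmx A) *m (1%:M + (-1) ^+ t *: conjmx B)) *t
       ((1%:M + (-1) ^+ (s (+) a) *: A) *m (1%:M + (-1) ^+ (t (+) b) *: B))).
  under eq_bigr => s _ do under eq_bigr => t _ do rewrite -tensmx_mul.
  under eq_bigr => s _ do rewrite -mulmx_sumr.
  rewrite -mulmx_suml -!sum -scalemxAl -scalemxAr !scalerA.
  by rewrite -[LHS]scale1r; congr (_ *: _); field.
apply: separableZ; first by rewrite invr_ge0 ler0n.
have comm (X Y : 'M[C]_n) (s t : bool) : X *m Y = Y *m X ->
    ((-1) ^+ s *: X) *m ((-1) ^+ t *: Y) = ((-1) ^+ t *: Y) *m ((-1) ^+ s *: X).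
  by move=> XY; rewrite -!scalemxAl -!scalemxAr XY !scalerA mulrC.
have psd (s t : bool) : separable (((1%:M + (-1) ^+ s *: conjmx A) *m (1%:M + (-1) ^+ t *: conjmx B)) *t
       ((1%:M + (-1) ^+ (s (+) a) *: A) *m (1%:M + (-1) ^+ (t (+) b) *: B))).
  apply: separable_tens; apply: psd_one_plus; try apply: hermitian_involution_sign => //.
  - exact: hermitian_involution_conj.
  - exact: hermitian_involution_conj.
  - by apply: comm; rewrite -!conjmx_mul AB.
  - exact: comm.
by rewrite !big_bool; do 2!apply: separableD.
Qed.

Lemma mulmx_one_plus n (A B : 'M[C]_n) c d :
  (1%:M + c *: A) *m (1%:M + d *: B) =
  1%:M + c *: A + d *: B + (c * d) *: (A *m B).
Proof.
rewrite mulmxDl !mulmxDr !mul1mx !mulmx1 -scalemxAl -scalemxAr scalerA.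
by rewrite addrA (addrAC 1%:M).
Qed.

(** * Vectorization and Choi matrices *)

Definition vecmx {d} (U : 'M[C]_d) : 'cV[C]_(d * d) :=
  \col_k U (mxtens_unindex k).2 (mxtens_unindex k).1.

Lemma sum_tens m n (F : 'I_(m * n) -> C) :
  \sum_k F k = \sum_i \sum_j F (mxtens_index (i, j)).
Proof.
rewrite pair_bigA /= (reindex (@mxtens_index m n)) /=.
  by apply: eq_bigr => -[i j].
exists (@mxtens_unindex m n) => k _; [exact: mxtens_indexK|exact: mxtens_unindexK].
Qed.

Lemma tens_vecmx d (A B U : 'M[C]_d) :
  (conjmx A *t B) *m vecmx U = vecmx (B *m U *m adjmx A).
Proof.
apply/colP => k; case: (mxtens_indexP k) => i j {k}.
rewrite !mxE sum_tens mxtens_indexK /=.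
apply: eq_bigr => a _; rewrite !mxE mulr_suml; apply: eq_bigr => b _.
by rewrite tensmxE !mxE !mxtens_indexK /=; ring.
Qed.

Lemma vecmx_norm d (U : 'M[C]_d) :
  (adjmx (vecmx U) *m vecmx U) 0 0 = \tr (adjmx U *m U).
Proof.
rewrite !mxE sum_tens; apply: eq_bigr => i _; rewrite !mxE.
by apply: eq_bigr => j _; rewrite !mxE mxtens_indexK.
Qed.

Lemma choiE d (L : 'M[C]_d -> 'M[C]_d) i j a b :
  choi L (mxtens_index (a, i)) (mxtens_index (b, j)) = L (delta_mx a b) i j.
Proof.
rewrite mxE !mxtens_indexK /=; congr (L _ i j); apply/matrixP => x y.
rewrite !mxE big_ord_recl big_ord0 addr0 !mxE !mxtens_indexK /= conjC_nat.
by rewrite -natrM mulnb eq_sym [b == y]eq_sym.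
Qed.

Lemma choi_psd d (L : 'M[C]_d -> 'M[C]_d) : completely_positive L -> psdmx (choi L).
Proof. by apply; rewrite -{1}[Omega d]adjmxK; apply: psd_gram. Qed.

End Matrices.

(** * Pauli diagonal maps *)

Section Pauli.
Variable R : realType.
Notation C := (R[i]).

Definition csg (b : bool) : C := (-1) ^+ b.

Definition pidx (a : pt) : 'I_4 := inord (pcode a).
Definition sigma (a : pt) : 'M[C]_2 := pauli (pidx a).
Definition isY (a : pt) : bool := a.1 && a.2.

Lemma val_pidx a : val (pidx a) = pcode a.
Proof. by rewrite /pidx /= inordK //; case: a => [[] []]. Qed.

Lemma pidx_bij : bijective pidx.
Proof.
exists (fun i : 'I_4 => (odd i, 1 < i)%N) => [a|i].
  by rewrite -[nat_of_ord _]/(val _) val_pidx; case: a => [[] []].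
by apply: val_inj; rewrite val_pidx; case: i => [[|[|[|[|//]]]]].
Qed.

Lemma sum_pidx (V : nmodType) (F : 'I_4 -> V) : \sum_(i < 4) F i = \sum_(a : pt) F (pidx a).
Proof. by rewrite (reindex pidx) //; apply: onW_bij pidx_bij. Qed.

Definition imagi : C := Complex 0 1.

Definition sigma_entry (a : pt) (x y : bool) : C :=
  if (x (+) y) == a.1 then
    (if a.2 then (if a.1 then (if x then imagi else - imagi) else csg x) else 1)
  else 0.

Definition bit (i : 'I_2) : bool := i == 1%N :> nat.

Lemma sigmaE a i j : sigma a i j = sigma_entry a (bit i) (bit j).
Proof.
rewrite /sigma /pauli val_pidx.
case: a => [[] []]; case: i => [[|[|//]] ?]; case: j => [[|[|//]] ?];
  by rewrite !mxE /sigma_entry /bit /csg /= ?expr0 ?expr1.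
Qed.

Lemma imagi2 : imagi * imagi = -1.
Proof. by rewrite /imagi; simpc. Qed.

Lemma conj_imagi : imagi^* = - imagi.
Proof. by apply/eqP; rewrite eq_complex /= oppr0 !eqxx. Qed.

Lemma eq_mx2 (A B : 'M[C]_2) :
  (forall x y : bool, A (inord x) (inord y) = B (inord x) (inord y)) -> A = B.
Proof.
move=> e; apply/matrixP => i j.
have ib (k : 'I_2) : k = inord (bit k).
  by apply: val_inj; rewrite [RHS]inordK; case: k => [[|[|//]]].
by rewrite (ib i) (ib j).
Qed.

Lemma bit_inord (x : bool) : bit (inord x) = x.
Proof. by rewrite /bit inordK; case: x. Qed.

Lemma sum_bit (F : 'I_2 -> C) : \sum_i F i = F (inord false) + F (inord true).
Proof.
by rewrite big_ord_recl big_ord1; congr (F _ + F _); apply: val_inj; rewrite [RHS]inordK.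
Qed.

(** The listed pairs are the cyclic ones XY, YZ, ZX, whose products carry the factor i. *)
Definition phase (a b : pt) : C :=
  if sp a b then
    if (a, b) \in [:: ((true, false), (true, true)); ((true, true), (false, true)); ((false, true), (true, false))]
    then imagi else - imagi
  else 1.

Lemma phase_unit a b : phase a b * (phase a b)^* = 1.
Proof.
rewrite /phase; case: ifP => _; last by rewrite rmorph1 mulr1.
by case: ifP => _; rewrite ?rmorphN /= conj_imagi ?mulrN ?mulNr ?opprK imagi2 ?opprK.
Qed.

Local Ltac pauli_cases :=
  rewrite /sigma_entry /phase /csg /= ?(mulr0, mul0r, addr0, add0r, expr0, expr1, mulr1, mul1r, mulrN, mulNr, opprK, oppr0, imagi2, rmorph0, rmorph1) //.

Lemma sigma_mul a b : sigma a *m sigma b = phase a b *: sigma (padd a b).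
Proof.
apply: eq_mx2 => x y; rewrite !mxE sum_bit !sigmaE !bit_inord.
by case: a b x y => [[] []] [[] []] [] []; pauli_cases.
Qed.

Lemma sigma_adj a : adjmx (sigma a) = sigma a.
Proof.
apply: eq_mx2 => x y; rewrite !mxE !sigmaE !bit_inord.
by case: a x y => [[] []] [] []; pauli_cases; rewrite ?rmorphN /= ?conj_imagi ?opprK ?rmorph1.
Qed.

Lemma sigma_tr a : (sigma a)^T = csg (isY a) *: sigma a.
Proof.
apply: eq_mx2 => x y; rewrite !mxE !sigmaE !bit_inord.
by case: a x y => [[] []] [] []; pauli_cases.
Qed.

Lemma sigma0 : sigma p0 = 1%:M.
Proof.
apply: eq_mx2 => x y; rewrite !mxE !sigmaE !bit_inord.
have -> : (inord x == inord y :> 'I_2) = (x == y).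
  by apply/eqP/eqP => [/(congr1 bit)|->//]; rewrite !bit_inord.
by case: x y => [] []; pauli_cases.
Qed.

Lemma tr_sigma a : \tr (sigma a) = 2 * (a == p0)%:R.
Proof.
rewrite /mxtrace sum_bit !sigmaE !bit_inord.
by case: a => [[] []]; pauli_cases; rewrite ?addrN ?addNr.
Qed.

(** * Two-qubit Pauli matrices and their Choi matrices *)

Definition pauli2 (g : vec) : 'M[C]_4 := sigma g.1 *t sigma g.2.

Lemma pauli2_mul g h : pauli2 g *m pauli2 h = (phase g.1 h.1 * phase g.2 h.2) *: pauli2 (vadd g h).
Proof.
apply: etrans (tensmx_mul (sigma g.1) (sigma g.2) (sigma h.1) (sigma h.2)) _.
by rewrite !sigma_mul tensmxZ.
Qed.

Lemma pauli2_comm g h : pauli2 g *m pauli2 h = csg (chi g h) *: (pauli2 h *m pauli2 g).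
Proof.
rewrite !pauli2_mul vaddC scalerA; congr (_ *: _).
have c a b : phase a b = csg (sp a b) * phase b a.
  by case: a b => [[] []] [[] []]; pauli_cases.
by rewrite (c g.1) (c g.2) mulrACA /csg -signr_addb.
Qed.

Lemma pauli2_adj g : adjmx (pauli2 g) = pauli2 g.
Proof.
apply: etrans (adjmx_tens (sigma g.1) (sigma g.2)) _.
by rewrite !sigma_adj.
Qed.

Lemma pauli2_tr g : (pauli2 g)^T = csg (isY g.1 (+) isY g.2) *: pauli2 g.
Proof.
apply: etrans (trmx_tens (sigma g.1) (sigma g.2)) _.
by rewrite !sigma_tr tensmxZ /csg -signr_addb.
Qed.

Lemma pauli2_0 : pauli2 v0 = 1%:M.
Proof.
rewrite /pauli2 !sigma0.
exact: (@tensmx11 C 2 2).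
Qed.

Lemma pauli2_sq g : pauli2 g *m pauli2 g = 1%:M.
Proof.
rewrite pauli2_mul -pauli2_0.
have -> : vadd g g = v0 by apply/eqP; rewrite vadd_eq0.
by case: g => [[[] []] [[] []]]; rewrite /phase /= mulr1 scale1r.
Qed.

Lemma pauli2_involution g : hermitian_involution (pauli2 g).
Proof. by split; [exact: pauli2_adj|exact: pauli2_sq]. Qed.

Lemma tr_tens m n (A : 'M[C]_m) (B : 'M[C]_n) : \tr (A *t B) = \tr A * \tr B.
Proof.
rewrite /mxtrace sum_tens mulr_suml; apply: eq_bigr => i _.
by rewrite mulr_sumr; apply: eq_bigr => j _; rewrite tensmxE.
Qed.

Lemma tr_pauli2_mul g h : \tr (pauli2 g *m pauli2 h) = 4 * (g == h)%:R.
Proof.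
have [->|gh] := eqVneq g h; first by rewrite pauli2_sq mxtrace1 mulr1.
have trpauli2 k : \tr (pauli2 k) = \tr (sigma k.1) * \tr (sigma k.2).
  by exact: (tr_tens (sigma k.1) (sigma k.2)).
have : vadd g h != v0 by rewrite vadd_eq0.
rewrite pauli2_mul linearZ /= trpauli2 !tr_sigma; case: (vadd g h) => a b.
by rewrite xpair_eqE negb_and => /orP[] /negPf /= ->; rewrite !(mulr0, mul0r).
Qed.

Definition coef (mu : 'M[R]_4) (g : vec) : R := mu (pidx g.1) (pidx g.2).

Lemma pauli_diagE mu X : pauli_diag mu X =
  \sum_(g : vec) ((coef mu g)%:C%C / 4 * \tr (pauli2 g *m X)) *: pauli2 g.
Proof.
rewrite /pauli_diag sum_pidx; under eq_bigr do rewrite sum_pidx.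
by rewrite pair_bigA.
Qed.

Definition diag_choi (m : vec -> R) : 'M[C]_(4 * 4) :=
  \sum_(g : vec) (m g)%:C%C *: (conjmx (pauli2 g) *t pauli2 g).

Lemma tr_mul_delta (A : 'M[C]_4) i j : \tr (A *m delta_mx i j) = A j i.
Proof.
rewrite -[A in LHS]mul1mx mxtrace_mulC mulmxA mulmx1.
rewrite /mxtrace (bigD1 i) //= big1 => [|k /negPf ki].
  rewrite addr0 mxE (bigD1 j) //= big1 => [|k /negPf kj].
    by rewrite mxE !eqxx mul1r addr0.
  by rewrite mxE kj andbF mul0r.
rewrite mxE big1 // => k' _; rewrite mxE ki andFb mul0r //.
Qed.

(** The trace of P E_ab is P_ba, which is the conjugate of P_ab because P is Hermitian; hence the
    conjugate in the first tensor factor. *)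
Lemma choi_pauli (L : 'M[C]_4 -> 'M[C]_4) (m : vec -> R) :
  (forall X, L X = \sum_(g : vec) ((m g)%:C%C / 4 * \tr (pauli2 g *m X)) *: pauli2 g) ->
  choi L = 4^-1 *: diag_choi m.
Proof.
move=> hL; apply/matrixP => k l.
case: (mxtens_indexP k) => a i; case: (mxtens_indexP l) => b j.
rewrite choiE hL mxE !summxE mulr_sumr; apply: eq_bigr => g _.
move: (pauli2 g) (pauli2_adj g) => A hA; rewrite !mxE tr_mul_delta !mxtens_indexK /=.
have -> : A b a = (A a b)^* by rewrite -[in LHS]hA !mxE.
by rewrite !mulrA [_ * 4^-1]mulrC.
Qed.

Definition doubled_pauli (g : vec) : 'M[C]_(4 * 4) := conjmx (pauli2 g) *t pauli2 g.

(** The phases of the two tensor factors are conjugate and cancel, so doubling makes the projective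
    Pauli representation a genuine one. *)
Lemma doubled_pauli_mul g h : doubled_pauli g *m doubled_pauli h = doubled_pauli (vadd g h).
Proof.
rewrite /doubled_pauli tensmx_mul -conjmx_mul pauli2_mul.
have -> c (A : 'M[C]_4) : conjmx (c *: A) = c^* *: conjmx A by exact: map_mxZ.
by rewrite tensmxZ [_^* * _]mulrC rmorphM mulrACA !phase_unit mulr1 scale1r.
Qed.

Lemma doubled_pauli0 : doubled_pauli v0 = 1%:M.
Proof. by rewrite /doubled_pauli pauli2_0 /conjmx map_mx1 tensmx11. Qed.

Lemma csgD a b : csg (a (+) b) = csg a * csg b.
Proof. by rewrite /csg signr_addb. Qed.

Lemma sgC s : (sg R s)%:C%C = csg s.
Proof. by rewrite /sg /csg rmorphXn /= rmorphN1. Qed.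

Lemma sum_stab n (F : vec -> 'M[C]_n) g h a b :
  \sum_(x : vec) (stab R g h a b x)%:C%C *: F x =
  F v0 + csg a *: F g + csg b *: F h + csg (a (+) b) *: F (vadd g h).
Proof.
have S k : \sum_(x : vec) ((x == k)%:R : R)%:C%C *: F x = F k.
  rewrite (bigD1 k) //= eqxx big1 => [|x /negPf->]; last by rewrite scale0r.
  by rewrite addr0 scale1r.
rewrite -[in RHS](S v0) -[in RHS](S g) -[in RHS](S h) -[in RHS](S (vadd g h)).
rewrite !scaler_sumr -!big_split /=; apply: eq_bigr => x _.
by rewrite /stab !rmorphD !rmorphM /= !sgC !scalerDl -!scalerA.
Qed.

(** A generator of the cone becomes the product treated by [separable_stabilizer]; separability is
    stable under the other constructors. *)
Lemma separable_diag_choi m : stab_cone m -> separable (diag_choi m).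
Proof.
elim=> {m} [g h a b gh||m m' _ IH _ IH'|c m c0 _ IH|m m' e _ IH].
- have AB : pauli2 g *m pauli2 h = pauli2 h *m pauli2 g by rewrite pauli2_comm gh /csg expr0 scale1r.
  have := separable_stabilizer (pauli2_involution g) (pauli2_involution h) AB a b.
  congr (separable _).
  rewrite /diag_choi (sum_stab doubled_pauli) -doubled_pauli_mul doubled_pauli0 csgD.
  rewrite -/(doubled_pauli g) -/(doubled_pauli h) -/(csg a) -/(csg b).
  exact: mulmx_one_plus.
- rewrite /diag_choi big1 => [|g _]; last by rewrite scale0r.
  exact: separable0.
- have := separableD IH IH'; congr (separable _); rewrite /diag_choi -big_split /=.
  by apply: eq_bigr => g _; rewrite rmorphD scalerDl.
- have c0' : 0 <= c%:C%C :> C by rewrite lecR.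
  have := separableZ c0' IH; congr (separable _); rewrite /diag_choi scaler_sumr.
  by apply: eq_bigr => g _; rewrite rmorphM scalerA.
- by move: IH; congr (separable _); apply: eq_bigr => g _; rewrite e.
Qed.

(** Conjugating one Pauli matrix by another only changes its sign, so the vectorized Pauli matrices
    are common eigenvectors of all the doubled ones. *)
Lemma diag_choi_vecmx m k :
  diag_choi m *m vecmx (pauli2 k) = (fourier m k)%:C%C *: vecmx (pauli2 k).
Proof.
rewrite /diag_choi mulmx_suml /fourier rmorph_sum /= scaler_suml.
apply: eq_bigr => g _.
rewrite -scalemxAl tens_vecmx pauli2_adj pauli2_comm -scalemxAl -mulmxA pauli2_sq mulmx1.
rewrite rmorphM /= mulrC -scalerA; congr (_ *: _).
rewrite chiC sgC.
by apply/colP => x; rewrite !mxE.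
Qed.

(** The Choi quadratic form is evaluated at an eigenvector; its squared norm 4 cancels the factor
    1/4. *)
Lemma fourier_ge0 (L : 'M[C]_4 -> 'M[C]_4) (m : vec -> R) k :
  (forall X, L X = \sum_(g : vec) ((m g)%:C%C / 4 * \tr (pauli2 g *m X)) *: pauli2 g) ->
  completely_positive L -> 0 <= fourier m k.
Proof.
move=> hL /choi_psd [_ /(_ (vecmx (pauli2 k)))].
rewrite (choi_pauli hL) -mulmxA -scalemxAl diag_choi_vecmx scalerA -scalemxAr mxE.
rewrite vecmx_norm pauli2_adj pauli2_sq mxtrace1 mulrAC mulVf ?pnatr_eq0 // mul1r.
by rewrite lecR.
Qed.

Lemma coef_valid (mu : 'M[R]_4) :
  completely_positive (pauli_diag mu) -> completely_copositive (pauli_diag mu) ->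
  valid (fourier (coef mu)).
Proof.
move=> cp ccp [f k]; rewrite /pval /=; case: f => /=; last first.
  exact: fourier_ge0 (pauli_diagE mu) cp.
pose m g := sg R (isY g.1 (+) isY g.2) * coef mu g.
have hL X : (pauli_diag mu X)^T = \sum_(g : vec) ((m g)%:C%C / 4 * \tr (pauli2 g *m X)) *: pauli2 g.
  rewrite pauli_diagE linear_sum /=; apply: eq_bigr => g _.
  rewrite linearZ /= pauli2_tr scalerA; congr (_ *: _).
  rewrite rmorphM /= sgC.
  by rewrite mulrC !mulrA.
(* Transposition flips the sign of Y, and conjugating by Y (x) Y moves the sign
   flips to the indices with exactly one trivial factor, counted by qf. *)
have := fourier_ge0 (vadd k ((true, true), (true, true))) hL ccp.
congr (0 <= _); rewrite (dual_fourier) /fourier; apply: eq_bigr => g _.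
rewrite /m mulrA -sgD; congr (sg R _ * _).
by case: g k => [[[] []] [[] []]] [[[] []] [[] []]].
Qed.

(** Trace orthogonality of the Pauli matrices makes the maps simultaneously diagonal, so their
    multipliers multiply. *)
Lemma comp_pauli_diag (mu nu : 'M[R]_4) X : (pauli_diag mu \o pauli_diag nu) X =
  \sum_(g : vec) ((coef mu g * coef nu g)%:C%C / 4 * \tr (pauli2 g *m X)) *: pauli2 g.
Proof.
rewrite /= !pauli_diagE; apply: eq_bigr => g _; congr (_ *: _).
rewrite mulmx_sumr linear_sum (bigD1 g) //= big1 => [|h /negPf hg].
  rewrite addr0 -scalemxAr linearZ /= tr_pauli2_mul eqxx mulr1 rmorphM; field => //.
by rewrite -scalemxAr linearZ /= tr_pauli2_mul eq_sym hg !mulr0.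
Qed.

End Pauli.

Theorem mainTheorem12 (R : realType) (mu1 mu2 : 'M[R]_4) :
  completely_positive (pauli_diag mu1) ->
  completely_copositive (pauli_diag mu1) ->
  completely_positive (pauli_diag mu2) ->
  completely_copositive (pauli_diag mu2) ->
  entanglement_breaking (pauli_diag mu1 \o pauli_diag mu2).
Proof.
move=> cp1 ccp1 cp2 ccp2; rewrite /entanglement_breaking (choi_pauli (comp_pauli_diag mu1 mu2)).
apply: separableZ; first by rewrite invr_ge0 ler0n.
apply: separable_diag_choi.
(* The weights of each map are the Fourier transform of its multipliers; transforming back gives a
   factor 16 for each map, and 16 * 16 = 256. *)
have c0 : 0 <= 256^-1 :> R by rewrite invr_ge0 ler0n.
apply: StabExt (StabScale c0 (stab_cone_mul (coef_valid cp1 ccp1) (coef_valid cp2 ccp2))).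
by move=> g; rewrite !fourierK; field.
Qed.
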